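(* For every integer $\alpha\ge 3$ we have $b(\alpha)\le \dfrac{\alpha-1}{\alpha(\alpha-2)}$ and, thus, $a(\alpha)\le \dfrac{2(\alpha-1)}{\alpha(\alpha-2)}$.
   Context: A graph means a finite graph, possibly with multiple (parallel) edges; each edge is a unit resistor, and $R_{xy}$ denotes effective resistance ($R_{xx}=0$; $R_{xy}=\infty$ if $x,y$ lie in different components). $e(G)$ is the number of edges. For an (unrooted) graph $G$ on $n$ vertices, $A'(G)=\frac1{n^2}\sum_{x,y\in V(G)}R_{xy}$. For a graph $G$ with a designated root vertex $\rho$, $B(G)=\frac{1}{|V(G)|-1}\sum_{x\in V(G)}R_{\rho x}$. Define $$a_n(\alpha)=\min\{A'(G):|V(G)|=n,\ e(G)\le \alpha n/2\},$$ $$b_n(\alpha)=\min\{B(G): G\text{ rooted},\ |V(G)|=n+1,\ e(G)\le \alpha n/2\},$$ and $a(\alpha)=\lim_{n\to\infty}a_n(\alpha)$, $b(\alpha)=\lim_{n\to\infty}b_n(\alpha)$; these limits exist for every $\alpha\ge 2$. *)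

(* Defs.v *)
From HB Require Import structures.
From mathcomp Require Import all_boot all_order all_algebra.
From mathcomp Require Import all_classical all_reals all_analysis.

Set Implicit Arguments.
Unset Strict Implicit.
Unset Printing Implicit Defensive.
Import Order.TTheory GRing.Theory Num.Theory.
Import numFieldNormedType.Exports.

Local Open Scope classical_set_scope.
Local Open Scope ring_scope.

(* Finite loopless graph with possibly parallel edges.  The orientation
   [src e -> tgt e] is an arbitrary reference orientation, used only to give
   signs to currents; the graph itself is undirected. *)
Record mgraph := MGraph {
  vertex : finType;
  edge : finType;
  src : edge -> vertex;
  tgt : edge -> vertex;
  loopless : forall e : edge, src e != tgt e }.

Definition adj (G : mgraph) : rel (vertex G) := fun x y =>
  [exists e : edge G, ((src e == x) && (tgt e == y)) ||
                      ((src e == y) && (tgt e == x))].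
Arguments adj : clear implicits.

Section Resistance.
Variables (R : realType) (G : mgraph).

(* Ohm's law, every edge being a unit resistor *)
Definition current (v : vertex G -> R) (e : edge G) : R :=
  v (src e) - v (tgt e).

Definition outflow (v : vertex G -> R) (z : vertex G) : R :=
  \sum_(e : edge G | src e == z) current v e
  - \sum_(e : edge G | tgt e == z) current v e.

(* Kirchhoff's node law for a unit current entering at [x] and leaving at [y] *)
Definition unit_potential (x y : vertex G) (v : vertex G -> R) : Prop :=
  forall z, outflow v z = (z == x)%:R - (z == y)%:R.

(* If [x] and [y] lie in the same component, a unit potential exists and its
   drop [v x - v y] does not depend on [v], so that the default value of [xget]
   is never used. *)
Definition eff_res (x y : vertex G) : \bar R :=
  if connect (adj G) x y then
    (xget 0 [set r : R | exists2 v, unit_potential x y v & r = v x - v y])%:E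
  else +oo%E.

Definition avg_res : \bar R :=
  (((#|vertex G| ^ 2)%:R^-1)%:E * \sum_(x : vertex G) \sum_(y : vertex G) eff_res x y)%E.

Definition root_avg_res (rho : vertex G) : \bar R :=
  ((#|vertex G|.-1%:R^-1)%:E * \sum_(x : vertex G) eff_res rho x)%E.

End Resistance.
Arguments avg_res : clear implicits.
Arguments root_avg_res : clear implicits.

(* For [alpha >= 2] and [n >= 1] the next two infima are minima: up to
   isomorphism only finitely many graphs are admissible, and at least one is. *)
Definition a_seq (R : realType) (alpha : R) (n : nat) : \bar R :=
  ereal_inf [set t | exists G : mgraph,
    [/\ #|vertex G| = n, #|edge G|%:R <= alpha * n%:R / 2
      & t = avg_res R G]].

Definition b_seq (R : realType) (alpha : R) (n : nat) : \bar R :=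
  ereal_inf [set t | exists (G : mgraph) (rho : vertex G),
    [/\ #|vertex G| = n.+1, #|edge G|%:R <= alpha * n%:R / 2
      & t = root_avg_res R G rho]].

Definition a_lim (R : realType) (alpha : R) : \bar R :=
  lim (a_seq alpha n @[n --> \oo]).

Definition b_lim (R : realType) (alpha : R) : \bar R :=
  lim (b_seq alpha n @[n --> \oo]).

(* Main.v *)
Require Import Defs.
From HB Require Import structures.
From mathcomp Require Import all_boot all_order all_algebra.
From mathcomp Require Import all_classical all_reals all_analysis.
From mathcomp Require Import fingroup perm ring lra zify.

Set Implicit Arguments.
Unset Strict Implicit.
Unset Printing Implicit Defensive.
Import Order.TTheory GRing.Theory Num.Theory.
Import numFieldNormedType.Exports.

Local Open Scope classical_set_scope.
Local Open Scope ring_scope.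

(* Upper bound on [b]: from a vertex of the infinite [alpha]-regular tree, the
   unit flow splitting evenly at every vertex has energy
   (alpha - 1) / (alpha (alpha - 2)).  Let the involutions exchanging the
   endpoints of the edges of a given colour act on a large finite ball of the
   properly coloured tree; the Cayley graph of these permutations looks like the
   tree around each of its vertices.  A sparse set of its vertices, which can be
   reached in boundedly many steps from anywhere in any branch, is joined to the
   root: after following the tree flow for many generations, the remaining
   bounded paths to the root cost a negligible energy.

   Convergence of [b_n]: gluing at the roots makes [n b_n] subadditive.

   Convergence of [a_n] to [2 b]: superposing flows to the root gives
   [a_(n+1) <= 2 b_n].  Conversely, sending a unit flow from a random vertex to
   a uniform random vertex has energy half of the average resistance; by
   sampling, the uniform target may be replaced by boundedly many vertices, which
   are joined to a new root.  The few additional edges are paid for by pendant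
   edges at the root, which use 1 < alpha / 2 edges per vertex. *)

(** * Flows and effective resistance *)

Section Flow.
Variables (R : realType) (G : mgraph).
Implicit Types (x y z : vertex G) (th : edge G -> R) (f v : vertex G -> R).

(* Kirchhoff's law tested against all functions on the vertices; in this weak
   form flows can be pushed forward along maps of graphs. *)
Definition flow x y th :=
  forall f, \sum_e th e * (f (src e) - f (tgt e)) = f x - f y.

Definition energy th := \sum_e th e ^+ 2.

Lemma energy_ge0 th : 0 <= energy th.
Proof. by apply: sumr_ge0 => e _; rewrite sqr_ge0. Qed.

Lemma energyN th : energy (fun e => - th e) = energy th.
Proof. by apply: eq_bigr => e _; rewrite sqrrN. Qed.

Lemma flowN x y th : flow x y th -> flow y x (fun e => - th e).
Proof.
move=> Hth f; rewrite -[RHS]opprB -Hth -sumrN.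
by apply: eq_bigr => e _; rewrite mulNr.
Qed.

Lemma flowB x y z th th' :
  flow x z th -> flow x y th' -> flow y z (fun e => th e - th' e).
Proof.
move=> H1 H2 f; transitivity ((f x - f z) - (f x - f y)); last by ring.
by rewrite -H1 -H2 -sumrB; apply: eq_bigr => e _; rewrite mulrBl.
Qed.

Lemma flow0 x : flow x x (fun=> 0).
Proof. by move=> f; rewrite subrr big1 // => e _; rewrite mul0r. Qed.

(** Summation by parts turns Kirchhoff's node law into its weak form. *)
Lemma sum_outflow f v :
  \sum_z f z * outflow v z
    = \sum_e current v e * (f (src e) - f (tgt e)).
Proof.
have sumE (g : edge G -> vertex G) :
    \sum_z f z * (\sum_(e | g e == z) current v e)
      = \sum_e current v e * f (g e).
  rewrite (partition_big g predT) //=; apply: eq_bigr => z _.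
  by rewrite big_distrr /=; apply: eq_bigr => e /eqP <-; rewrite mulrC.
under eq_bigr do rewrite mulrBr.
rewrite sumrB !sumE -sumrB; apply: eq_bigr => e _.
by rewrite mulrBr.
Qed.

Lemma sum_mul_eq (I : finType) (F : I -> R) (i : I) :
  \sum_j F j * (j == i)%:R = F i.
Proof.
rewrite (bigD1 i) //= eqxx mulr1 big1 ?addr0 // => j /negPf ->.
by rewrite mulr0.
Qed.

Lemma unit_potential_flow x y v : unit_potential x y v -> flow x y (current v).
Proof.
move=> Hv f; rewrite -sum_outflow.
under eq_bigr do rewrite Hv mulrBr.
by rewrite sumrB !sum_mul_eq.
Qed.

Lemma energy_current x y v :
  flow x y (current v) -> energy (current v) = v x - v y.
Proof. by move=> <-; apply: eq_bigr => e _; rewrite expr2. Qed.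

Lemma connect_const (T : Type) (c : vertex G -> T) x y :
  (forall e : edge G, c (src e) = c (tgt e)) -> connect (adj G) x y -> c x = c y.
Proof.
move=> Hc /connectP [p Hp ->] {y}.
elim: p x Hp => //= a p IHp x /andP [/existsP [e He] Hp].
rewrite -(IHp _ Hp).
by case/orP: He => /andP [/eqP <- /eqP <-].
Qed.

(** The indicator of the component of [x] is constant along edges, so if [y] lay outside, testing
    the flow against it would give 0 = 1. *)
Lemma flow_connect x y th : flow x y th -> connect (adj G) x y.
Proof.
move=> Hth; apply/negPn/negP => nxy.
have := Hth (fun z => (connect (adj G) x z)%:R).
rewrite connect0 (negPf nxy) subr0 big1 => [/eqP|e _].
  by rewrite eq_sym oner_eq0.
suff -> : connect (adj G) x (src e) = connect (adj G) x (tgt e).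
  by rewrite subrr mulr0.
apply/idP/idP => H; apply: (connect_trans H); apply: connect1;
  by apply/existsP; exists e; rewrite !eqxx ?orbT.
Qed.

Lemma outflowE v z :
  outflow v z = \sum_e current v e * current (fun z' => (z' == z)%:R) e.
Proof. by rewrite -sum_outflow; under eq_bigr do rewrite mulrC; rewrite sum_mul_eq. Qed.

(** With [B] the incidence matrix, [B *m B^T] is the Laplacian. A column of its cokernel has zero
    Dirichlet energy, hence is constant on components and orthogonal to [d]. *)
Lemma exists_unit_potential x y :
  connect (adj G) x y -> exists v, unit_potential x y v.
Proof.
move=> xy.
pose B : 'M[R]_(#|vertex G|, #|edge G|) := \matrix_(i, j)
  current (fun z => (z == enum_val i)%:R) (enum_val j).
pose d : 'rV[R]_#|vertex G| := \row_i
  ((enum_val i == x)%:R - (enum_val i == y)%:R).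
have reV (F : vertex G -> R) : \sum_(i < #|vertex G|) F (enum_val i) = \sum_z F z.
  by rewrite [RHS](reindex _ (onW_bij _ (@enum_val_bij _))).
have reE (F : edge G -> R) : \sum_(i < #|edge G|) F (enum_val i) = \sum_e F e.
  by rewrite [RHS](reindex _ (onW_bij _ (@enum_val_bij _))).
have BE v e : \sum_z v z * current (fun z' => (z' == z)%:R) e = current v e.
  have E a : \sum_z v z * (a == z)%:R = v a.
    by under eq_bigr do rewrite eq_sym; rewrite sum_mul_eq.
  by rewrite /current; under eq_bigr do rewrite mulrBr; rewrite sumrB !E.
suff /submxP [u Hu] : (d <= B *m B^T)%MS.
  pose v z := u 0 (enum_rank z).
  have Hc e : (u *m B) 0 (enum_rank e) = current v e.
    rewrite mxE -BE -reV; apply: eq_bigr => i _.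
    by rewrite mxE /v enum_rankK enum_valK.
  exists v => z; rewrite outflowE -reE.
  have /(congr1 (fun M : 'rV[R]_#|vertex G| => M 0 (enum_rank z))) := Hu.
  rewrite mxE enum_rankK => ->.
  rewrite mulmxA mxE; apply: eq_bigr => j _.
  by rewrite -Hc enum_valK !mxE enum_rankK.
rewrite submxE.
set C := cokermx _.
have HC : B *m B^T *m C = 0 by rewrite mulmx_coker.
have HBC : B^T *m C = 0.
  have H0 : (B^T *m C)^T *m (B^T *m C) = 0.
    by rewrite trmx_mul trmxK -mulmxA (mulmxA B) HC mulmx0.
  apply/matrixP => i j; rewrite [RHS]mxE.
  have /(congr1 (fun M : 'M[R]_#|vertex G| => M j j)) := H0.
  rewrite [LHS]mxE [RHS]mxE => /eqP.
  under eq_bigr do rewrite [X in X * _]mxE -expr2.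
  rewrite psumr_eq0 => [/allP /(_ i)|k _]; last exact: sqr_ge0.
  by rewrite mem_index_enum sqrf_eq0 => /(_ isT) /eqP.
apply/eqP/matrixP => i j; rewrite [RHS]mxE [LHS]mxE.
pose c z := C (enum_rank z) j.
have Hc (e : edge G) : c (src e) = c (tgt e).
  apply/eqP; rewrite -subr_eq0.
  have /(congr1 (fun M : 'M[R]_(#|edge G|, #|vertex G|) => M (enum_rank e) j)) := HBC.
  rewrite [RHS]mxE [LHS]mxE => H; rewrite -[X in X == _]/(current c e) -BE -reV.
  rewrite -[X in _ == X]H; apply/eqP; apply: eq_bigr => k _.
  by rewrite /c enum_valK mulrC; congr (_ * _); rewrite !mxE enum_rankK.
transitivity (\sum_z c z * ((z == x)%:R - (z == y)%:R)).
  rewrite -reV; apply: eq_bigr => k _; rewrite /c enum_valK mulrC.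
  by congr (_ * _); rewrite mxE.
under eq_bigr do rewrite mulrBr.
by rewrite sumrB !sum_mul_eq (connect_const Hc xy) subrr.
Qed.

(** Both drops equal the symmetric pairing of the two currents. *)
Lemma reciprocity x y v v' :
  flow x y (current v) -> flow x y (current v') -> v x - v y = v' x - v' y.
Proof.
by move=> Hv Hv'; rewrite -Hv' -Hv; apply: eq_bigr => e _; rewrite mulrC.
Qed.

Lemma eff_res_unit_potential x y : connect (adj G) x y ->
  exists2 v, flow x y (current v) & eff_res R x y = (energy (current v))%:E.
Proof.
move=> xy; rewrite /eff_res xy.
have [v0 Hv0] := exists_unit_potential xy.
case: xgetP => [r _ [v /unit_potential_flow Hv ->]|/(_ (v0 x - v0 y))].
  by exists v => //; rewrite (energy_current Hv).
by case; exists v0.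
Qed.

Lemma eff_res_current x y v :
  flow x y (current v) -> eff_res R x y = (energy (current v))%:E.
Proof.
move=> Hv; have [v' Hv' ->] := eff_res_unit_potential (flow_connect Hv).
by rewrite (energy_current Hv) (energy_current Hv') (reciprocity Hv Hv').
Qed.

(* Thomson's principle *)
Lemma eff_res_le x y th : flow x y th -> (eff_res R x y <= (energy th)%:E)%E.
Proof.
move=> Hth; have [v Hv ->] := eff_res_unit_potential (flow_connect Hth).
rewrite lee_fin.
have : 0 <= \sum_e (th e - current v e) ^+ 2.
  by apply: sumr_ge0 => e _; rewrite sqr_ge0.
suff -> : \sum_e (th e - current v e) ^+ 2 = energy th - energy (current v).
  by rewrite subr_ge0.
(* The cross term is the flow [th] tested against the potential [v]. *)
transitivity (energy th - (v x - v y) *+ 2 + energy (current v)).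
  rewrite -Hth -sumrMnl -sumrB -big_split /=; apply: eq_bigr => e _.
  by rewrite sqrrB.
by rewrite (energy_current Hv); ring.
Qed.

Lemma eff_res_ge0 x y : (0 <= eff_res R x y)%E.
Proof.
have [xy|nxy] := boolP (connect (adj G) x y); last by rewrite /eff_res (negPf nxy).
by have [v _ ->] := eff_res_unit_potential xy; rewrite lee_fin energy_ge0.
Qed.

Lemma eff_res_fin x y : (eff_res R x y < +oo)%E -> connect (adj G) x y.
Proof. by rewrite /eff_res; case: ifP. Qed.

End Flow.

(** * Rooted graphs *)

Section Rooted.
Variable R : realType.

(** Flows serve as certificates: by Thomson's principle [s / n] bounds the root average. The total
    energy is recorded because totals add under gluing. *)
Definition rooted_net (n k : nat) (s : R) :=
  exists (G : mgraph) (rho : vertex G) (th : vertex G -> edge G -> R),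
  [/\ #|vertex G| = n.+1, #|edge G| = k, forall x, flow rho x (th x)
    & \sum_x energy (th x) <= s].

Lemma rooted_net_ge0 n k s : rooted_net n k s -> 0 <= s.
Proof.
case=> G [rho [th [_ _ _]]]; apply: le_trans.
by apply: sumr_ge0 => x _; apply: energy_ge0.
Qed.

Lemma rooted_net_root_avg n k s : rooted_net n k s ->
  exists (G : mgraph) (rho : vertex G), [/\ #|vertex G| = n.+1, #|edge G| = k
    & (root_avg_res R G rho <= (s / n%:R)%:E)%E].
Proof.
move=> [G [rho [th [Vn Ek Hth Hs]]]]; exists G, rho; split=> //.
rewrite /root_avg_res Vn /= mulrC EFinM; apply: lee_wpmul2l.
  by rewrite lee_fin invr_ge0.
apply: le_trans (_ : (\sum_x (energy (th x))%:E <= _)%E); last first.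
  by rewrite sumEFin lee_fin.
by apply: lee_sum => x _; apply: eff_res_le.
Qed.

Lemma le_esum_ge0 (I : finType) (F : I -> \bar R) (i : I) :
  (forall j, 0 <= F j)%E -> (F i <= \sum_j F j)%E.
Proof.
by move=> F0; rewrite (bigD1 i) //= leeDl // sume_ge0.
Qed.

Lemma root_avg_rooted_net (G : mgraph) (rho : vertex G) n r :
  #|vertex G| = n.+1 -> (0 < n)%N -> (root_avg_res R G rho <= r%:E)%E ->
  rooted_net n #|edge G| (r * n%:R).
Proof.
move=> Vn n0; rewrite /root_avg_res Vn /= lee_pdivrMl ?ltr0n // -EFinM => Hr.
(* A finite sum of nonnegative resistances has finite terms, so the root reaches every vertex. *)
have Hc x : connect (adj G) rho x.
  apply: (@eff_res_fin R); apply: le_lt_trans (ltry (n%:R * r)).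
  by apply: le_trans Hr; apply: le_esum_ge0 => y; apply: eff_res_ge0.
have /choice [v Hv] : forall x, exists v, flow rho x (current v) /\
    eff_res R rho x = (energy (current v))%:E.
  by move=> x; have [v] := @eff_res_unit_potential R _ _ _ (Hc x); exists v.
exists G, rho, (fun x => current (v x)); split=> // [x|]; first by have [] := Hv x.
rewrite mulrC -lee_fin -sumEFin; apply: le_trans Hr; apply: lee_sum => x _.
by have [_ ->] := Hv x.
Qed.

Lemma rooted_net_edge : rooted_net 1 1 1.
Proof.
pose G := @MGraph bool unit (fun=> true) (fun=> false) (fun=> isT).
have sumE F : \sum_(e : edge G) F e = F tt :> R.
  by rewrite (big_pred1 tt) => [|[]].
exists G, true, (fun x _ => (~~ x)%:R); split.
- by rewrite card_bool.
- by rewrite card_unit.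
- by move=> x f; rewrite sumE; case: x => /=; ring.
- by rewrite big_bool /energy !sumE /=; lra.
Qed.

(** The roots are identified and each flow is extended by zero to the other graph, so non-root
    vertices, edges and energy bounds all add. *)
Lemma rooted_net_glue n1 k1 s1 n2 k2 s2 :
  rooted_net n1 k1 s1 -> rooted_net n2 k2 s2 ->
  rooted_net (n1 + n2) (k1 + k2) (s1 + s2).
Proof.
move=> [G1 [r1 [th1 [V1 E1 F1 S1]]]] [G2 [r2 [th2 [V2 E2 F2 S2]]]].
pose V : finType := (vertex G1 + {x | x \in predC1 r2})%type.
pose j (x : vertex G2) : V := if insub x is Some x' then inr x' else inl r1.
have jr : j r2 = inl r1 by rewrite /j insubF // inE eqxx.
have jK x' : j (val x') = inr x' by rewrite /j valK.
have j_inj : injective j.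
  move=> x y; rewrite /j.
  case: insubP => [x' _ <-|]; case: insubP => [y' _ <-|] //; first by move=> [->].
  by rewrite !inE !negbK => /eqP -> /eqP ->.
pose s (e : edge G1 + edge G2) : V :=
  match e with inl e => inl (src e) | inr e => j (src e) end.
pose t (e : edge G1 + edge G2) : V :=
  match e with inl e => inl (tgt e) | inr e => j (tgt e) end.
have st e : s e != t e.
  case: e => e /=; first by rewrite (inj_eq (@inl_inj _ _)) loopless.
  by rewrite (inj_eq j_inj) loopless.
pose G := @MGraph V (edge G1 + edge G2)%type s t st.
pose th (x : vertex G) (e : edge G) : R := match x, e with
  | inl x, inl e => th1 x e | inr x, inr e => th2 (val x) e | _, _ => 0 end.
exists G, (inl r1), th; split.
- rewrite card_sum card_sig V1 -[X in _ = (_ + X).+1]/(n2.+1.-1) -V2.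
  by rewrite (cardC1 r2) V2.
- by rewrite card_sum E1 E2.
- move=> [x|x] f; rewrite big_sumType /=.
    rewrite [X in _ + X]big1 ?addr0 => [|e _]; last by rewrite mul0r.
    exact: F1 x (f \o inl).
  rewrite big1 ?add0r => [|e _]; last by rewrite mul0r.
  by have := F2 (val x) (f \o j); rewrite /= jr jK.
- rewrite big_sumType /=; apply: lerD.
    apply: le_trans S1; apply: ler_sum => x _.
    rewrite /energy big_sumType /= [X in _ + X]big1 ?addr0 // => e _.
    by rewrite expr0n.
  apply: le_trans S2.
  rewrite [leRHS](bigD1 r2) //=.
  apply: ler_wpDl; first exact: energy_ge0.
  rewrite (big_sub (predC1 r2) (fun x => energy (th2 x))) /=.
  apply: ler_sum => x _.
  rewrite /energy big_sumType /= big1 ?add0r // => e _.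
  by rewrite expr0n.
Qed.
End Rooted.

(** * Rooted graphs and average resistance *)

Section Average.
Variable R : realType.

Lemma big_option (I : finType) (F : option I -> R) :
  \sum_x F x = F None + \sum_x F (Some x).
Proof.
rewrite (bigD1 None) //=; congr (_ + _).
rewrite (reindex_omap Some id) => [|[x|] //].
by apply: eq_bigl => x; rewrite eqxx.
Qed.

Lemma sum_sqr_diff (I : finType) (d : I -> R) :
  \sum_x \sum_y (d y - d x) ^+ 2
    = (#|I|%:R * \sum_x d x ^+ 2) *+ 2 - (\sum_x d x) ^+ 2 *+ 2.
Proof.
transitivity (\sum_x (\sum_y d y ^+ 2 + #|I|%:R * d x ^+ 2
                      - (d x * \sum_y d y) *+ 2)).
  apply: eq_bigr => x _; rewrite mulr_sumr -sumrMnl.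
  rewrite [#|I|%:R * _]mulr_natl -sumr_const -big_split -sumrB /=.
  by apply: eq_bigr => y _; ring.
rewrite sumrB big_split /= sumr_const sumrMnl -mulr_suml -mulr_sumr.
by rewrite mulr_natl; ring.
Qed.

Lemma sum_sqr_shift (I : finType) (d : I -> R) (c : R) :
  \sum_x d x = 0 -> \sum_x (d x - c) ^+ 2 = \sum_x d x ^+ 2 + #|I|%:R * c ^+ 2.
Proof.
move=> d0; transitivity (\sum_x (d x ^+ 2 + c ^+ 2 - c * d x *+ 2)).
  by apply: eq_bigr => x _; ring.
rewrite sumrB big_split /= sumr_const sumrMnl -mulr_sumr d0 mulr_natl.
by ring.
Qed.

Lemma exists_le_average (I : finType) (F : I -> R) (r : R) :
  (0 < #|I|)%N -> \sum_x F x <= #|I|%:R * r -> exists x, F x <= r.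
Proof.
move=> I0 HF; apply/existsP; apply: contraLR HF => /existsPn HF.
rewrite -ltNge mulr_natl -sumr_const.
case/card_gt0P: I0 => i _; apply: ltr_sum => [|x _]; last by rewrite ltNge.
by apply/hasP; exists i => //; rewrite mem_index_enum.
Qed.

(* Superposing the flows from the root, [R_xy <= |th_x - th_y|^2]. *)
Lemma rooted_net_avg n k (s : R) : rooted_net n k s ->
  exists G : mgraph, [/\ #|vertex G| = n.+1, #|edge G| = k
    & (avg_res R G <= (2 * s / n.+1%:R)%:E)%E].
Proof.
move=> [G [rho [th [Vn Ek Hth Hs]]]]; exists G; split=> //.
rewrite /avg_res Vn lee_pdivrMl ?ltr0n ?expn_gt0 // -EFinM.
apply: le_trans (_ : ((\sum_x \sum_y energy (fun e => th y e - th x e))%:E <= _)%E).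
  rewrite -sumEFin; apply: lee_sum => x _; rewrite -sumEFin; apply: lee_sum => y _.
  by apply: eff_res_le; apply: flowB (Hth y) (Hth x).
rewrite lee_fin.
under eq_bigr do rewrite exchange_big /=.
rewrite exchange_big /=.
apply: le_trans (_ : \sum_e (n.+1%:R * \sum_x th x e ^+ 2) *+ 2 <= _).
  (* The squared sum of the flows through [e] is discarded. *)
  apply: ler_sum => e _; rewrite sum_sqr_diff Vn lerBlDr lerDl mulrn_wge0 //.
  exact: sqr_ge0.
rewrite sumrMnl -mulr_sumr exchange_big /= natrX.
have -> : n.+1%:R ^+ 2 * (2 * s / n.+1%:R) = (n.+1%:R * s) *+ 2 :> R.
  by field; rewrite ?nat1r ?natr1 pnatr_eq0.
by rewrite lerMn2r ler_pM2l ?ltr0n.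
Qed.

(* Maurey's sampling argument, with the points chosen greedily *)
Lemma exists_sample (I E : finType) (d : I -> E -> R) (r : R) (m : nat) :
  (0 < #|I|)%N -> (forall e, \sum_x d x e = 0) ->
  \sum_x \sum_e d x e ^+ 2 <= #|I|%:R * r ->
  exists s : m.-tuple I, \sum_e (\sum_(z <- s) d z e) ^+ 2 <= m%:R * r.
Proof.
move=> I0 d0 Hr; elim: m => [|m [s Hs]].
  exists [tuple]; rewrite mul0r big1 // => e _.
  by rewrite big_nil expr0n.
pose w e := \sum_(z <- s) d z e.
(* Averaged over [x], the cross term with [w] vanishes because [d] is centred, so some [x] raises
   the bound by at most [r]. *)
have [|x Hx] := @exists_le_average I (fun x => \sum_e (d x e + w e) ^+ 2)
    (m.+1%:R * r) I0.
  rewrite exchange_big /=.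
  under eq_bigr => e _.
    under eq_bigr do rewrite -[w e]opprK.
    rewrite sum_sqr_shift // sqrrN.
    over.
  rewrite big_split /= -mulr_sumr exchange_big /= -natr1 mulrDl mul1r mulrDr.
  by rewrite addrC lerD // ler_pM2l ?ltr0n.
exists [tuple of x :: s]; apply: le_trans Hx; apply: ler_sum => e _.
by rewrite big_cons.
Qed.

(* In terms of currents [J x] from a base vertex to [x], with mean [M], one has
   [R_xy = |J x - J y|^2], so that the variance of [J] is half of the average
   resistance.  Join [m] sample vertices to a new root: the flow from the root
   to [x] through the sample costs [|J x - mean of J over the sample|^2 + 1/m]. *)
Lemma avg_res_rooted_net (G : mgraph) n m (r : R) :
  #|vertex G| = n -> (0 < n)%N -> (0 < m)%N -> (avg_res R G <= r%:E)%E ->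
  rooted_net n (#|edge G| + m) (n%:R * (r / 2 * (1 + m%:R^-1) + m%:R^-1)).
Proof.
move=> Vn n0 m0 Hr.
have nR : 0 < n%:R :> R by rewrite ltr0n.
have mR : 0 < m%:R :> R by rewrite ltr0n.
move: Hr; rewrite /avg_res Vn lee_pdivrMl ?ltr0n ?expn_gt0 ?n0 // -EFinM => Hr.
have V0 : (0 < #|vertex G|)%N by rewrite Vn.
have [b _] := card_gt0P V0.
have Hc x : connect (adj G) b x.
  apply: (@eff_res_fin R); apply: le_lt_trans (ltry ((n ^ 2)%:R * r)).
  apply: le_trans Hr; apply: le_trans (le_esum_ge0 b _); last first.
    by move=> y; apply: sume_ge0 => z _; apply: eff_res_ge0.
  by apply: le_esum_ge0 => y; apply: eff_res_ge0.
have /choice [v Hv] : forall x, exists v : vertex G -> R, flow b x (current v).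
  by move=> x; have [v] := @eff_res_unit_potential R _ _ _ (Hc x); exists v.
pose J x := current (v x).
have RJ x y : eff_res R x y = (energy (fun e => J y e - J x e))%:E.
  have E : current (fun z => v y z - v x z) = (fun e => J y e - J x e).
    by apply/funext => e; rewrite /J /current; ring.
  by rewrite -E; apply: eff_res_current; rewrite E; apply: flowB.
pose M e := n%:R^-1 * \sum_x J x e.
pose d x e := J x e - M e.
have d0 e : \sum_x d x e = 0.
  rewrite sumrB sumr_const Vn -[M e *+ n]mulr_natl mulrA divff ?gt_eqF // mul1r.
  by rewrite subrr.
have Hd : \sum_x \sum_e d x e ^+ 2 <= n%:R * (r / 2).
  move: Hr; under eq_bigr do under eq_bigr do rewrite RJ.
  under eq_bigr do rewrite sumEFin.
  rewrite sumEFin lee_fin.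
  have -> : \sum_x \sum_y energy (fun e => J y e - J x e)
      = (n%:R * \sum_x \sum_e d x e ^+ 2) *+ 2.
    transitivity (\sum_x \sum_y \sum_e (d y e - d x e) ^+ 2).
      do 3 apply: eq_bigr => ? _; rewrite /d; congr (_ ^+ 2); ring.
    under eq_bigr do rewrite exchange_big /=.
    rewrite exchange_big /=.
    under eq_bigr do rewrite sum_sqr_diff d0 expr0n mul0rn subr0 Vn.
    by rewrite sumrMnl -mulr_sumr exchange_big.
  rewrite natrX expr2 -mulrA -mulrnAr ler_pM2l // => H.
  by rewrite mulrA ler_pdivlMr // mulr_natr.
move: Hd; rewrite -{1}Vn => Hd; have [s Hs] := exists_sample m V0 d0 Hd.
pose ss (e : edge G + 'I_m) : option (vertex G) :=
  match e with inl e => Some (src e) | inr j => Some (tnth s j) end.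
pose tt (e : edge G + 'I_m) : option (vertex G) :=
  match e with inl e => Some (tgt e) | inr j => None end.
have st e : ss e != tt e.
  by case: e => e //=; rewrite (inj_eq Some_inj) loopless.
pose G' := @MGraph (option (vertex G)) (edge G + 'I_m)%type ss tt st.
pose S e := m%:R^-1 * \sum_(z <- s) J z e.
(* All [J z] start at [b], so in [J x - S] the base point cancels: it leads from the averaged sample
   to [x]. The new edges point to the root, whence the sign. *)
pose th (x : vertex G') (e : edge G') : R := match x with
  | None => 0
  | Some x => match e with inl e => J x e - S e | inr j => - m%:R^-1 end end.
exists G', None, th; split.
- by rewrite card_option Vn.
- by rewrite card_sum card_ord.
- case=> [x|]; last exact: flow0.
  move=> f; rewrite big_sumType /=.
  pose g z := f (Some z).
  have -> : \sum_e (J x e - S e) * (f (Some (src e)) - f (Some (tgt e)))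
     = (g b - g x) - m%:R^-1 * \sum_(z <- s) (g b - g z).
    under [in RHS]eq_bigr do rewrite -(Hv _ g).
    rewrite -(Hv x g).
    rewrite exchange_big /= mulr_sumr -sumrB; apply: eq_bigr => e _.
    by rewrite mulrBl /S -mulr_suml mulrA.
  rewrite -mulr_sumr sumrB big_const_seq count_predT size_tuple iter_addr_0.
  rewrite sumrB sumr_const card_ord -[g b *+ m]mulr_natr -[f None *+ m]mulr_natr.
  rewrite -(big_tuple _ _ s predT g).
  by rewrite /g; field; rewrite gt_eqF.
- rewrite big_option /= {1}/energy /= [X in X + _]big1 ?add0r; last first.
    by move=> e _; rewrite expr0n.
  under eq_bigr do rewrite /energy big_sumType /= sqrrN sumr_const card_ord.
  rewrite big_split /= sumr_const Vn.
  have -> : m%:R^-1 ^+ 2 *+ m *+ n = n%:R / m%:R :> R.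
    by rewrite -mulr_natr -[_ *+ m]mulr_natr; field; rewrite gt_eqF.
  rewrite mulrDr lerD2r exchange_big /=.
  pose c e := m%:R^-1 * \sum_(z <- s) d z e.
  have -> : \sum_e \sum_x (J x e - S e) ^+ 2 = \sum_e \sum_x (d x e - c e) ^+ 2.
    apply: eq_bigr => e _; apply: eq_bigr => x _; congr (_ ^+ 2).
    rewrite /c /d sumrB big_const_seq count_predT size_tuple iter_addr_0 /S.
    by rewrite -[M e *+ m]mulr_natr; field; rewrite gt_eqF.
  under eq_bigr do rewrite sum_sqr_shift //.
  rewrite big_split /= -mulr_sumr exchange_big /= mulrDr mulr1 mulrDr lerD //; first by rewrite -Vn.
  rewrite Vn ler_pM2l //.
  under eq_bigr do rewrite exprMn.
  rewrite -mulr_sumr; apply: le_trans (_ : m%:R^-1 ^+ 2 * (m%:R * (r / 2)) <= _).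
    by rewrite ler_wpM2l ?sqr_ge0.
  by rewrite le_eqVlt; apply/orP; left; apply/eqP; field; rewrite gt_eqF.
Qed.
End Average.

(** * A tree-like graph *)

Section ReducedWords.
Variables (C : finType) (K : nat).
Implicit Types (c : C) (w : seq C).

Definition reduced w := sorted (fun c c' => c != c') w.
Arguments reduced : simpl never.

Lemma reduced_cons c w : reduced (c :: w) = (ohead w != Some c) && reduced w.
Proof. by case: w => //= c' w; rewrite /reduced /= [c == c']eq_sym. Qed.

(* The reduced words of length at most [K] form the ball of radius [K] in a
   regular tree whose edges are properly coloured by [C]; [toggle c] exchanges
   the endpoints of every edge of colour [c] and fixes the other vertices.
   Non-reduced words are fixed as well. *)
Definition toggle c w :=
  if reduced w && (ohead w == Some c) then behead w
  else if reduced (c :: w) && (size w < K)%N then c :: w else w.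

Lemma size_toggle c w : (size w <= K)%N -> (size (toggle c w) <= K)%N.
Proof.
move=> wK; rewrite /toggle; case: ifP => _; last by case: ifP => // /andP [].
by rewrite size_behead (leq_trans (leq_pred _)).
Qed.

Lemma toggleK c w : (size w <= K)%N -> toggle c (toggle c w) = w.
Proof.
move=> wK; rewrite {2}/toggle.
case: ifP => [/andP []|H1].
  case: w wK => //= c' w wK=> rw /eqP [E].
  rewrite {}E in rw wK *.
  have := rw; rewrite reduced_cons => /andP [/negPf hw rw'].
  by rewrite /toggle hw andbF rw wK.
case: ifP => [/andP [rcw _]|H2]; last by rewrite /toggle H1 H2.
by rewrite /toggle rcw /= eqxx.
Qed.

(** Letters are only pushed, never cancelled, so the image of the empty word determines a short
    reduced word. *)
Lemma foldr_toggle w :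
  reduced w -> (size w <= K)%N -> foldr toggle [::] w = w.
Proof.
elim: w => //= c w IHw rcw wK.
have := rcw; rewrite reduced_cons => /andP [/negPf hw rw].
rewrite IHw ?(ltnW wK) // /toggle hw andbF wK andbT.
by rewrite rcw.
Qed.

Definition toggle_bseq c (t : K.-bseq C) : K.-bseq C :=
  Bseq (size_toggle c (size_bseq t)).

Lemma toggle_bseqK c : involutive (toggle_bseq c).
Proof. by move=> t; apply: val_inj; rewrite /= toggleK // size_bseq. Qed.

Definition toggle_perm c : {perm K.-bseq C} := perm (inv_inj (toggle_bseqK c)).

Lemma toggle_permK c : (toggle_perm c * toggle_perm c = 1)%g.
Proof. by apply/permP => t; rewrite permM !permE /= toggle_bseqK. Qed.

(** Words grow at the head, so the branch below [w] consists of the words with suffix [w]; branches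
    of equal depth are thus disjoint. *)
Lemma suffix_uniq w1 w2 w :
  suffix w1 w -> suffix w2 w -> size w1 = size w2 -> w1 = w2.
Proof. by rewrite !suffixE => /eqP H1 /eqP H2 E; rewrite -H1 -H2 E. Qed.

End ReducedWords.
Arguments reduced : simpl never.

(** * The rooted Cayley graph and its flows *)

Section TreeLike.
Variables (R : realType) (a K L : nat).
Local Notation C := 'I_a.+3.
Local Notation X := {perm K.-bseq C}.
Local Notation Y := (X * 'Z_L.+2)%type.
Local Notation c0 := (ord0 : C).
Local Notation c1 := (inord 1 : C).

(** Reflections are involutions, as the action of a colour must be, and composing that of [c0] with
    another one translates by one. *)
Definition reflect_letter (c : C) (u : 'Z_L.+2) := if c == c0 then 1 - u else - u.

Definition act (c : C) (y : Y) : Y :=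
  ((y.1 * toggle_perm K c)%g, reflect_letter c y.2).

Lemma actK c : involutive (act c).
Proof.
move=> [g u]; rewrite /act /= -mulgA toggle_permK mulg1 /reflect_letter.
by case: (c == c0); rewrite ?opprK // opprB addrC subrK.
Qed.

(* The [bool] coordinate makes the graph bipartite, so that every edge has a
   canonical orientation; [None] is the root. *)
Definition net_src (e : Y * C + X * bool) : option (Y * bool) :=
  match e with inl (y, _) => Some (y, false) | inr (g, b) => Some ((g, 0), b) end.

Definition net_tgt (e : Y * C + X * bool) : option (Y * bool) :=
  match e with inl (y, c) => Some (act c y, true) | inr _ => None end.

Lemma net_loopless e : net_src e != net_tgt e.
Proof.
by case: e => [[y c]|[g b]] //=; rewrite (inj_eq Some_inj) xpair_eqE andbF.
Qed.

Definition net := MGraph net_loopless.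

Definition step (c : C) (v : Y * bool) : Y * bool := (act c v.1, ~~ v.2).

(** An edge is stored at its endpoint on the [false] side; for [v] on the [true] side this is the
    neighbour. *)
Definition dart (c : C) (v : Y * bool) : edge net :=
  if v.2 then inl (act c v.1, c) else inl (v.1, c).

Definition dart_flow (c : C) (v : Y * bool) : edge net -> R :=
  fun e => (-1) ^+ v.2 * (e == dart c v)%:R.

Lemma dart_flowP c v :
  @flow R net (Some v) (Some (step c v)) (dart_flow c v).
Proof.
move=> f; rewrite (bigD1 (dart c v)) //= big1 => [|e /negPf He].
  rewrite /dart_flow eqxx addr0 mulr1.
  case: v => [y []]; rewrite /dart /step /= ?actK; ring.
by rewrite /dart_flow He mulr0 mul0r.
Qed.

Lemma energy_dart_flow c v : energy (dart_flow c v) = 1.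
Proof.
rewrite /energy (bigD1 (dart c v)) //= big1 => [|e /negPf He].
  by rewrite /dart_flow eqxx mulr1 sqrr_sign addr0.
by rewrite /dart_flow He mulr0 expr0n.
Qed.

Lemma sqr_sum_disjoint (I : finType) (D : {set I}) (F : I -> R) :
  {in D &, forall i j, i != j -> F i * F j = 0} ->
  (\sum_(i in D) F i) ^+ 2 = \sum_(i in D) F i ^+ 2.
Proof.
move=> HF; rewrite expr2 big_distrlr /=; apply: eq_bigr => i iD.
rewrite (bigD1 i) //= big1 ?addr0 ?expr2 // => j /andP [jD ji].
by rewrite HF // eq_sym.
Qed.

Section FromVertex.
Variable v : Y * bool.

Definition walk (w : seq C) : Y * bool := foldr step v w.

(* A short reduced word can be read off the endpoint of the walk it spells, by
   letting the permutation act on the root of the tree. *)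
Definition label (v' : Y * bool) : seq C := v'.1.1 ((v.1.1)^-1%g [bseq]).

Lemma label_walk w : reduced w -> (size w <= K)%N -> label (walk w) = w.
Proof.
move=> rw wK; rewrite -[RHS](foldr_toggle rw wK) /label.
elim: w {rw wK} => [|c w IHw] /=; first by rewrite permKV.
by rewrite permM permE /= -IHw.
Qed.

(** The root counts as below every [w], since all branches may end there; edges are still separated
    by their sources, which are never the root. *)
Definition below (w : seq C) (x : option (Y * bool)) :=
  if x is Some v' then suffix w (label v') else true.

Lemma below_cons c w x : below (c :: w) x -> below w x.
Proof.
by case: x => //= v'; apply: suffix_trans; apply: suffix_cons.
Qed.

(* A unit flow to the root from the endpoint of the walk [w], using only edges
   in the branch of the tree below [w]; flows in different branches have
   disjoint supports, hence their energies add up. *)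
Definition escape (w : seq C) (r : R) := exists th : edge net -> R,
  [/\ @flow R net (Some (walk w)) None th, energy th <= r
    & forall e, th e != 0 -> below w (src e) && below w (tgt e)].

Lemma escape_le w r r' : r <= r' -> escape w r -> escape w r'.
Proof.
by move=> rr' [th [H1 H2 H3]]; exists th; split=> //; apply: le_trans rr'.
Qed.

Lemma escape_root w :
  reduced w -> (size w <= K)%N -> (walk w).1.2 = 0 -> escape w 1.
Proof.
move=> rw wK; move: (label_walk rw wK); rewrite /escape.
case: (walk w) => [[g u] b] /= Hl u0; rewrite {u}u0 in Hl *.
pose e0 : edge net := inr (g, b).
exists (fun e => (e == e0)%:R); split.
- move=> f; rewrite (bigD1 e0) //= big1 ?addr0 => [|e /negPf ->]; last by rewrite mul0r.
  by rewrite eqxx mul1r.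
- rewrite /energy (bigD1 e0) //= big1 => [|e /negPf ->].
    by rewrite eqxx expr1n addr0.
  by rewrite expr0n.
- move=> e; case: (e =P e0) => [-> _|_]; last by rewrite eqxx.
  by rewrite /= andbT Hl suffix_refl.
Qed.

(** The flow splits evenly over [D]. Each first edge and branch carries [1 / #|D|], and disjoint
    supports give energy at most [#|D| * (1 + r) / #|D| ^ 2]. *)
Lemma escape_step w (D : {set C}) r : (0 < #|D|)%N ->
  reduced w -> (size w < K)%N ->
  {in D, forall c, ohead w != Some c /\ escape (c :: w) r} ->
  escape w ((1 + r) / #|D|%:R).
Proof.
move=> D0 rw ltwK HD; have wK := ltnW ltwK.
have DR : 0 < #|D|%:R :> R by rewrite ltr0n.
have /choice [th Hth] : forall c, exists th : edge net -> R, c \in D ->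
  [/\ @flow R net (Some (walk (c :: w))) None th, energy th <= r
    & forall e, th e != 0 -> below (c :: w) (src e) && below (c :: w) (tgt e)].
  move=> c; case: (boolP (c \in D)) => [/HD [_ [th Hth]]|_]; first by exists th.
  by exists (fun=> 0).
pose d c := dart_flow c (walk w).
have d0 c e : d c e != 0 -> e = dart c (walk w).
  by rewrite /d /dart_flow; case: (e =P dart c (walk w)) => // _; rewrite mulr0 eqxx.
(* The start is not below [c :: w], so the first edges avoid the supports of the branch flows. *)
have nbelow c : below (c :: w) (Some (walk w)) = false.
  rewrite /= label_walk //; apply/negP => /size_suffix.
  by rewrite /= ltnn.
have dth c c' e : c' \in D -> d c e * th c' e = 0.
  move=> /Hth [_ _ H]; apply/eqP; rewrite mulf_eq0 -[_ || _]negbK negb_or.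
  apply/negP => /andP [/d0 -> /H].
  have := nbelow c'; rewrite /dart.
  by case: (walk w) => [y []] /=; rewrite ?actK => ->; rewrite ?andbF.
have dd c c' e : c != c' -> d c e * d c' e = 0.
  move=> cc'; apply/eqP; rewrite mulf_eq0 -[_ || _]negbK negb_or.
  pose letter (e : edge net) := if e is inl (_, c) then c else c0.
  apply/negP => /andP [/d0 -> /d0 /(congr1 letter)].
  by rewrite /dart; case: (walk w).2 => /= E; rewrite E eqxx in cc'.
have thth c c' e : c \in D -> c' \in D -> c != c' -> th c e * th c' e = 0.
  move=> /Hth [_ _ H] /Hth [_ _ H'] cc'; apply/eqP.
  rewrite mulf_eq0 -[_ || _]negbK negb_or.
  apply/negP => /andP [/H /andP [+ _] /H' /andP [+ _]].
  have [v' ->] : exists v', src e = Some v' by case: e => [[y ?]|[g b]]; eexists.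
  move=> /= s1 s2; have [E] := suffix_uniq s1 s2 erefl.
  by rewrite E eqxx in cc'.
pose Th e := #|D|%:R^-1 * \sum_(c in D) (d c e + th c e).
exists Th; split.
- move=> f; rewrite /Th.
  under eq_bigr do rewrite -mulrA mulr_suml.
  rewrite -mulr_sumr exchange_big /=.
  apply: (mulfI (lt0r_neq0 DR)); rewrite mulVKf ?lt0r_neq0 //.
  rewrite mulr_natl -sumr_const; apply: eq_bigr => c cD.
  have [Hf _ _] := Hth _ cD.
  under eq_bigr do rewrite mulrDl.
  by rewrite big_split /= Hf dart_flowP /=; ring.
- rewrite /energy /Th.
  under eq_bigr => e _.
    rewrite exprMn sqr_sum_disjoint; last first.
      move=> c c' cD c'D cc'.
      rewrite mulrDl !mulrDr dd // dth // thth // [th c e * _]mulrC dth //.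
      by rewrite !addr0.
    over.
  rewrite -mulr_sumr exchange_big /=.
  apply: le_trans (_ : #|D|%:R^-1 ^+ 2 * \sum_(c in D) (1 + r) <= _).
    rewrite ler_wpM2l ?sqr_ge0 //; apply: ler_sum => c cD.
    have [_ Hr _] := Hth _ cD.
    apply: le_trans (_ : energy (d c) + energy (th c) <= _); last first.
      by rewrite energy_dart_flow lerD2l.
    rewrite -big_split /= le_eqVlt; apply/orP; left; apply/eqP.
    by apply: eq_bigr => e _; rewrite sqrrD dth // mul0rn addr0.
  rewrite sumr_const -mulr_natl le_eqVlt; apply/orP; left; apply/eqP.
  by field; rewrite gt_eqF.
- move=> e; rewrite /Th mulf_eq0 negb_or => /andP [_ Hs].
  have [c cD] : exists2 c, c \in D & d c e + th c e != 0.
    apply/exists_inP; apply: contraNT Hs => /exists_inPn Hn.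
    by apply/eqP/big1 => c /Hn; rewrite negbK => /eqP.
  have [/eqP -> |/d0 -> _] := boolP (d c e == 0).
    rewrite add0r; have [_ _ H] := Hth _ cD => /H /andP [H1 H2].
    by rewrite (below_cons H1) (below_cons H2).
  have lw := label_walk rw wK; have lcw : label (step c (walk w)) = c :: w.
    rewrite -[step _ _]/(walk (c :: w)) label_walk // reduced_cons rw andbT.
    by have [] := HD _ cD.
  suff [[-> ->]|[-> ->]] :
      (src (dart c (walk w)) = Some (walk w) /\
       tgt (dart c (walk w)) = Some (step c (walk w))) \/
      (src (dart c (walk w)) = Some (step c (walk w)) /\
       tgt (dart c (walk w)) = Some (walk w)).
  + by rewrite /= lw lcw suffix_refl suffix_cons.
  + by rewrite /= lw lcw suffix_refl suffix_cons.
  rewrite /dart /step; case: (walk w) => [y []] /=; first by rewrite actK; right.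
  by left.
Qed.

Lemma escape_step1 w c r : reduced w -> (size w < K)%N -> ohead w != Some c ->
  escape (c :: w) r -> escape w (1 + r).
Proof.
move=> rw wK hw Hc.
have := @escape_step w [set c]%SET r; rewrite cards1 divr1; apply=> //.
by move=> c'; rewrite inE => /eqP ->.
Qed.

(* Alternating the letters [c0] and [c1] translates the ['Z_L.+2] coordinate, so
   that it reaches the fibre [0] joined to the root; the letter at the head of
   [w] decides which of the two comes first. *)
Lemma escape_alternate w (j : nat) : reduced w -> (size w + j.*2 <= K)%N ->
  (ohead w != Some c0 /\ (walk w).1.2 = j%:R) \/
  (ohead w != Some c1 /\ (walk w).1.2 = - j%:R) ->
  escape w (1 + j.*2%:R).
Proof.
have c01 : c0 != c1 by rewrite -val_eqE /= inordK.
elim: j w => [|j IHj] w rw wK Hw.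
  rewrite addr0; rewrite addn0 in wK; apply: escape_root => //.
  by case: Hw => -[_ ->]; rewrite ?oppr0.
have E : 1 + j.+1.*2%:R = 1 + (1 + (1 + j.*2%:R)) :> R.
  by rewrite doubleS -!natr1; ring.
rewrite {}E; rewrite doubleS in wK.
have wK2 : ((size w).+2 <= K)%N.
  by apply: leq_trans wK; rewrite !addnS !ltnS leq_addr.
have wK' c c' : (size [:: c, c' & w] + j.*2 <= K)%N.
  by rewrite /= !addSn -!addnS.
case: Hw => -[hw Hu].
  have rw0 : reduced (c0 :: w) by rewrite reduced_cons hw.
  have h01 : ohead (c0 :: w) != Some c1 by rewrite (inj_eq Some_inj).
  have rw1 : reduced [:: c1, c0 & w] by rewrite reduced_cons h01.
  apply: (escape_step1 rw _ hw); first exact: ltnW.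
  apply: (escape_step1 rw0 _ h01) => //; apply: IHj => //.
  left; split; first by rewrite (inj_eq Some_inj) eq_sym.
  rewrite /= /reflect_letter eqxx eq_sym (negPf c01) Hu -natr1; ring.
have rw1 : reduced (c1 :: w) by rewrite reduced_cons hw.
have h10 : ohead (c1 :: w) != Some c0 by rewrite (inj_eq Some_inj) eq_sym.
have rw0 : reduced [:: c0, c1 & w] by rewrite reduced_cons h10.
apply: (escape_step1 rw _ hw); first exact: ltnW.
apply: (escape_step1 rw1 _ h10) => //; apply: IHj => //.
right; split; first by rewrite (inj_eq Some_inj).
rewrite /= /reflect_letter eqxx eq_sym (negPf c01) Hu -natr1; ring.
Qed.

(** At most [L.+2] alternating pairs of steps, then one edge into the root. *)
Definition tail_bound : R := 1 + L.+2.*2%:R.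

Lemma escape_tail w : reduced w -> (size w + L.+2.*2 <= K)%N ->
  escape w tail_bound.
Proof.
move=> rw wK.
have [j [jL Hj]] : exists j, (j <= L.+2)%N /\
  ((ohead w != Some c0 /\ (walk w).1.2 = j%:R) \/
   (ohead w != Some c1 /\ (walk w).1.2 = - j%:R)).
  set u := (walk w).1.2.
  have [hw|hw] := boolP (ohead w != Some c0).
    by exists u; split; [exact: ltnW (ltn_ord u) | left; rewrite natr_Zp].
  exists (- u); split; [exact: ltnW (ltn_ord (- u)) | right].
  rewrite natr_Zp opprK; split=> //.
  move: hw; rewrite negbK => /eqP ->; rewrite (inj_eq Some_inj).
  by rewrite -val_eqE /= inordK.
apply: escape_le (escape_alternate rw _ Hj); last by lia.
by rewrite lerD2l ler_nat leq_double.
Qed.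

(** The value [1 / (a + 1)] is the fixed point of [r -> (1 + r) / (a + 2)], the recursion for
    [a + 2] children; the excess over it is at least halved in each generation. *)
Lemma escape_branch h w : reduced w -> w != [::] ->
  (size w + h + L.+2.*2 <= K)%N ->
  escape w (a.+1%:R^-1 + tail_bound / 2 ^+ h).
Proof.
have a0 : 0 < a.+1%:R :> R by rewrite ltr0n.
have tb0 : 0 <= tail_bound by rewrite addr_ge0.
elim: h w => [|h IHh] w rw w0 wK.
  apply: escape_le (escape_tail rw _); last by lia.
  by rewrite expr0 divr1 lerDr invr_ge0 ltW.
pose D : {set C} := [set c | ohead w != Some c]%SET.
have cD : #|D| = a.+2.
  rewrite {}/D; case: w w0 {rw wK} => // c w _; rewrite -[RHS]/(a.+3.-1).
  rewrite -[X in X.-1](card_ord a.+3) -(cardC1 c).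
  by apply: eq_card => c'; rewrite !inE /= eq_sym.
apply: escape_le (escape_step (D := D) (r := a.+1%:R^-1 + tail_bound / 2 ^+ h) _ _ _ _);
  rewrite ?cD //; last 2 first.
- by lia.
- move=> c; rewrite inE => hw; split=> //; apply: IHh => //=; last by rewrite addSnnS.
  by rewrite reduced_cons hw.
rewrite ler_pdivrMr ?ltr0n // -[a.+2%:R]natr1 exprS invfM mulrA.
set t := tail_bound / 2 ^+ h.
have t0 : 0 <= t by rewrite divr_ge0 // exprn_ge0.
have -> : tail_bound / 2 / 2 ^+ h = t / 2 by rewrite /t; ring.
have iA : a.+1%:R^-1 * a.+1%:R = 1 :> R by rewrite mulVf ?gt_eqF.
have tA : 0 <= t * (a.+1%:R - 1) by rewrite mulr_ge0 // subr_ge0 ler1n.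
by move: iA tA; set i := _^-1; set A := a.+1%:R => iA tA; lra.
Qed.

(** At the origin no letter is excluded, so the last split is over [a + 3] branches. *)
Lemma escape_origin h : (h.+1 + L.+2.*2 <= K)%N ->
  escape [::] (a.+2%:R / (a.+3%:R * a.+1%:R) + tail_bound / 2 ^+ h).
Proof.
have a0 : 0 < a.+1%:R :> R by rewrite ltr0n.
have tb0 : 0 <= tail_bound by rewrite addr_ge0.
move=> hK.
apply: escape_le (escape_step (D := [set: C]%SET) (r := a.+1%:R^-1 + tail_bound / 2 ^+ h) _ _ _ _);
  rewrite ?cardsT ?card_ord //; last 2 first.
- by apply: leq_trans hK.
- by move=> c _; split=> //; apply: escape_branch.
rewrite addrA mulrDl; apply: lerD.
  rewrite le_eqVlt; apply/orP; left; apply/eqP.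
  have a_ge0 := ler0n R a; rewrite -!natr1; field.
  by apply/andP; split; apply: lt0r_neq0; lra.
rewrite ler_pdivrMr ?ltr0n // ler_peMr ?divr_ge0 ?exprn_ge0 //.
by rewrite ler1n.
Qed.
End FromVertex.
End TreeLike.

(** Here [p] counts the vertices joined to the root, a fraction [1 / (L + 2)] of the non-root
    vertices. Every non-root vertex serves as an origin. *)
Lemma tree_like_net (R : realType) (a h L : nat) : exists2 p, (0 < p)%N &
  rooted_net (p * L.+2) (p * L.+2 * a.+3 %/ 2 + p)
    ((p * L.+2)%:R * (a.+2%:R / (a.+3%:R * a.+1%:R) + (1 + L.+2.*2%:R) / 2 ^+ h) : R).
Proof.
pose K := (h.+1 + L.+2.*2)%N.
pose X : finType := {perm K.-bseq 'I_a.+3}.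
have /choice [th Hth] : forall x : vertex (net a K L),
   exists th : edge (net a K L) -> R,
   @flow R (net a K L) None x th /\ energy th <= if x is Some _ then
     a.+2%:R / (a.+3%:R * a.+1%:R) + tail_bound R L / 2 ^+ h else 0.
  move=> [v|]; last first.
    exists (fun=> 0); split; first exact: flow0.
    by rewrite /energy big1 // => e _; rewrite expr0n.
  have [th [H1 H2 _]] := @escape_origin R a K L v h (leqnn _).
  by exists (fun e => - th e); rewrite energyN; split=> //; apply: flowN.
have cX : (0 < #|X|)%N by apply/card_gt0P; exists 1%g.
exists (#|X| * 2)%N; first by rewrite muln_gt0 cX.
exists (net a K L), None, th; split.
- by rewrite /= card_option !card_prod card_ord card_bool mulnAC.
- rewrite /= card_sum !card_prod !card_ord card_bool.
  have -> : (#|X| * 2 * L.+2 * a.+3 = #|X| * L.+2 * a.+3 * 2)%N by lia.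
  by rewrite mulnK.
- by move=> x; have [] := Hth x.
- rewrite big_option -[leRHS]add0r; apply: lerD; first by have [] := Hth None.
  set r := _ + _.
  apply: le_trans (_ : \sum_(x : X * 'Z_L.+2 * bool) r <= _).
    by apply: ler_sum => x _; have [] := Hth (Some x).
  by rewrite sumr_const !card_prod card_ord card_bool mulr_natl mulnAC.
Qed.

(** * Limits *)

Section Limits.
Variables (R : realType) (alpha : nat).
Hypothesis halpha : (3 <= alpha)%N.

Definition admissible (n : nat) (s : R) :=
  exists2 k, (k.*2 <= alpha * n)%N & rooted_net n k s.

Lemma admissible_glue n s n' s' :
  admissible n s -> admissible n' s' -> admissible (n + n') (s + s').
Proof.
move=> [k Hk H] [k' Hk' H']; exists (k + k')%N; last exact: rooted_net_glue.
by rewrite doubleD mulnDr leq_add.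
Qed.

Lemma rooted_net0 : rooted_net 0 0 (0 : R).
Proof.
pose G := @MGraph unit void (fun=> tt) (fun=> tt) (fun e => match e with end).
exists G, tt, (fun _ _ => 0); split; rewrite ?card_unit ?card_void //.
- by case; apply: flow0.
- by rewrite big1 // => x _; rewrite /energy big1 // => -[].
Qed.

Lemma rooted_net_star m : rooted_net m m (m%:R : R).
Proof.
elim: m => [|m IHm]; first exact: rooted_net0.
rewrite -addn1 natrD; apply: rooted_net_glue IHm _; exact: rooted_net_edge.
Qed.

Lemma admissible_star m : admissible m m%:R.
Proof. by exists m; [nia | apply: rooted_net_star]. Qed.

Lemma admissible_mul q n s : admissible n s -> admissible (q * n) (q%:R * s).
Proof.
move=> Hs; elim: q => [|q IHq].
  by rewrite mul0n mul0r; apply: admissible_star 0%N.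
by rewrite mulSn -nat1r mulrDl mul1r; apply: admissible_glue.
Qed.

(* Since [alpha >= 3], every pendant edge at the root frees half an edge. *)
Lemma admissible_slack n k m s : rooted_net n k s ->
  (k.*2 <= alpha * n + m.*2)%N -> admissible (n + m.*2) (s + m.*2%:R).
Proof.
move=> Hs Hk; exists (k + m.*2)%N; first by nia.
exact: rooted_net_glue Hs (rooted_net_star _).
Qed.

(* As rooted graphs can be glued at their roots, [n * b_n] is subadditive, so
   that by Fekete's argument this infimum is the limit of [b_n]. *)
Definition densities : set R :=
  [set r | exists n s, [/\ (0 < n)%N, admissible n s & r = s / n%:R]].

Definition min_density : R := inf densities.

Lemma has_inf_densities : has_inf densities.
Proof.
split; first by exists (1%:R / 1%:R), 1%N, 1%:R; split=> //; apply: admissible_star.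
exists 0 => _ [n [s [n0 [k _ Hs] ->]]].
by rewrite divr_ge0 ?ler0n // (rooted_net_ge0 Hs).
Qed.

Lemma min_density_le n s :
  (0 < n)%N -> admissible n s -> min_density <= s / n%:R.
Proof.
move=> n0 Hs; apply: ge_inf; first exact: (proj2 has_inf_densities).
by exists n, s.
Qed.

Lemma min_density_ge0 : 0 <= min_density.
Proof.
apply: lb_le_inf; first by case: has_inf_densities.
move=> _ [n [s [n0 [k _ Hs] ->]]].
by rewrite divr_ge0 ?ler0n // (rooted_net_ge0 Hs).
Qed.

Lemma min_density_le1 : min_density <= 1.
Proof. by have := min_density_le (ltn0Sn 0) (admissible_star 1); rewrite divr1. Qed.

Lemma edge_bound n k : (k%:R <= alpha%:R * n%:R / 2 :> R) = (k.*2 <= alpha * n)%N.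
Proof. by rewrite ler_pdivlMr // -natrM -natrM ler_nat muln2. Qed.

Lemma b_seq_le n s : (0 < n)%N -> admissible n s ->
  (b_seq (alpha%:R : R) n <= (s / n%:R)%:E)%E.
Proof.
move=> n0 [k Hk /rooted_net_root_avg [G [rho [Vn Ek Hs]]]].
apply: le_trans Hs; apply: ereal_inf_lbound; exists G, rho.
by rewrite Ek edge_bound.
Qed.

Lemma b_seq_ge n : (0 < n)%N -> (min_density%:E <= b_seq (alpha%:R : R) n)%E.
Proof.
move=> n0; rewrite leNgt; apply/negP => /ereal_inf_lt [_ [G [rho [Vn Ek ->]]]].
case E : (root_avg_res R G rho) => [r||] //; last first.
  move=> _; suff : (0 <= root_avg_res R G rho)%E by rewrite E.
  apply: mule_ge0; rewrite ?lee_fin ?invr_ge0 ?ler0n //.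
  by apply: sume_ge0 => x _; apply: eff_res_ge0.
rewrite lte_fin ltNge => /negP; apply.
rewrite -[r](mulfK (_ : n%:R != 0)) ?pnatr_eq0 -?lt0n //.
apply: min_density_le => //; exists #|edge G|; first by rewrite -edge_bound.
by apply: (root_avg_rooted_net (rho := rho) Vn n0); rewrite E.
Qed.

(** The root becomes an ordinary vertex, hence the shift to [n.+1]. *)
Lemma a_seq_le n s : admissible n s ->
  (a_seq (alpha%:R : R) n.+1 <= (2 * s / n.+1%:R)%:E)%E.
Proof.
move=> [k Hk /rooted_net_avg [G [Vn Ek Hs]]].
apply: le_trans Hs; apply: ereal_inf_lbound; exists G.
by split=> //; rewrite Ek edge_bound (leq_trans Hk) // leq_mul.
Qed.

(** The [m] edges to the new root may exceed the budget; [m.*2] pendant edges pay for them and add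
    at most [2 * m / n] to the density. *)
Lemma a_seq_ge n m : (0 < n)%N -> (0 < m)%N ->
  ((min_density * 2 - 4 / m%:R - 4 * m%:R / n%:R)%:E <= a_seq (alpha%:R : R) n)%E.
Proof.
move=> n0 m0; rewrite leNgt; apply/negP => /ereal_inf_lt [_ [G [Vn Ek ->]]].
have nR : 0 < n%:R :> R by rewrite ltr0n.
have mR : 0 < m%:R :> R by rewrite ltr0n.
case E : (avg_res R G) => [r||] //; last first.
  move=> _; suff : (0 <= avg_res R G)%E by rewrite E.
  apply: mule_ge0; rewrite ?lee_fin ?invr_ge0 ?ler0n //.
  by apply: sume_ge0 => x _; apply: sume_ge0 => y _; apply: eff_res_ge0.
rewrite lte_fin ltNge => /negP; apply.
have Er : (avg_res R G <= r%:E)%E by rewrite E.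
have Hnet := avg_res_rooted_net Vn n0 m0 Er.
rewrite edge_bound in Ek.
have Hm : ((#|edge G| + m).*2 <= alpha * n + m.*2)%N by rewrite doubleD leq_add2r.
have nm0 : (0 < n + m.*2)%N by rewrite addn_gt0 n0.
have := min_density_le nm0 (admissible_slack Hnet Hm).
have := min_density_le1; set b := min_density => b1.
rewrite ler_pdivlMr ?ltr0n // natrD mulrDr => H.
have bm0 : 0 <= b * m.*2%:R by rewrite mulr_ge0 // min_density_ge0.
have {}H : b <= r / 2 * (1 + m%:R^-1) + m%:R^-1 + 2 * m%:R / n%:R.
  rewrite -(ler_pM2l nR).
  have -> : n%:R * (r / 2 * (1 + m%:R^-1) + m%:R^-1 + 2 * m%:R / n%:R)
     = n%:R * (r / 2 * (1 + m%:R^-1) + m%:R^-1) + m.*2%:R.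
    by rewrite -muln2 natrM; field; rewrite !gt_eqF.
  lra.
(* As [b <= 1], the bound is clear for [r >= 2]; otherwise [r / 2 < 1] and the sampling errors total
   at most [2 / m]. *)
have [r2|r2] := lerP 2 r.
  have : 0 <= 4 / m%:R :> R by rewrite divr_ge0 ?ltW.
  have : 0 <= 4 * m%:R / n%:R :> R by rewrite divr_ge0 ?mulr_ge0 ?ltW.
  lra.
have : 0 <= m%:R^-1 :> R by rewrite invr_ge0 ltW.
set i := m%:R^-1 in H * => i0.
have E2 : 4 * m%:R / n%:R = 2 * (2 * m%:R / n%:R) :> R by ring.
rewrite E2; set j := 2 * m%:R / n%:R in H *.
have : 0 <= i * (2 - r) by rewrite mulr_ge0 // subr_ge0 ltW.
lra.
Qed.

(** * Convergence and the tree bound *)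

Lemma ereal_squeeze_cvg (u : nat -> \bar R) (l : R) :
  (forall e, 0 < e -> \forall n \near \oo, ((l - e)%:E <= u n <= (l + e)%:E)%E) ->
  u n @[n --> \oo] --> l%:E.
Proof.
move=> Hu; apply/fine_cvgP; split.
  near=> n; have /andP [H1 H2] : ((l - 1)%:E <= u n <= (l + 1)%:E)%E.
    by near: n; apply: Hu.
  rewrite fin_numE -ltNye -ltey (lt_le_trans (ltNyr _) H1).
  exact: le_lt_trans H2 (ltry _).
apply/cvgrPdist_le => e e0; near=> n.
have /andP [] : ((l - e)%:E <= u n <= (l + e)%:E)%E by near: n; apply: Hu.
case E : (u n) => [x||] //; rewrite /= E /= !lee_fin ler_distlC => -> ->.
Unshelve. all: by end_near.
Qed.

Lemma near_ge_div (c e : R) : 0 < e -> \forall n \near \oo, c / n%:R <= e.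
Proof.
move=> e0; near=> n.
have n0 : 0 < n%:R :> R by rewrite ltr0n; near: n; exists 1%N.
rewrite ler_pdivrMr // mulrC -ler_pdivrMr //.
by near: n; exact: nbhs_infty_ger.
Unshelve. all: by end_near.
Qed.

(** A nearly optimal block on [k] non-root vertices is repeated [n %/ k] times, and pendant edges
    fill the remainder at a density cost below [k / n]. *)
Lemma admissible_near e : 0 < e ->
  \forall n \near \oo, exists2 s, admissible n s & s <= (min_density + e) * n%:R.
Proof.
move=> e0; have e20 : 0 < e / 2 by rewrite divr_gt0.
have [_ [k [s [k0 Hs ->]] Hk]] := inf_adherent e20 has_inf_densities.
near=> n.
have n0 : 0 < n%:R :> R by rewrite ltr0n; near: n; exists 1%N.
exists ((n %/ k)%:R * s + (n %% k)%:R).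
  rewrite {1}(divn_eq n k); apply: admissible_glue; first exact: admissible_mul.
  exact: admissible_star.
have k0R : 0 < k%:R :> R by rewrite ltr0n.
have s0 : 0 <= s by case: Hs => ? _ /rooted_net_ge0.
have Hkn : k%:R / n%:R <= e / 2 by near: n; apply: near_ge_div.
apply: le_trans (_ : (s / k%:R + k%:R / n%:R) * n%:R <= _); last first.
  by rewrite ler_wpM2r ?ltW //; move: Hk; rewrite -/min_density; lra.
rewrite mulrDl mulfVK ?gt_eqF // lerD //.
  rewrite -mulrA mulrC ler_wpM2l // mulrC ler_pdivlMr // -natrM ler_nat.
  exact: leq_trunc_div.
by rewrite ler_nat ltnW // ltn_mod.
Unshelve. all: by end_near.
Qed.

Lemma b_seq_cvg : b_seq (alpha%:R : R) n @[n --> \oo] --> min_density%:E.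
Proof.
apply: ereal_squeeze_cvg => e e0; near=> n.
have n0 : (0 < n)%N by near: n; exists 1%N.
have [s Hs Hse] : exists2 s, admissible n s & s <= (min_density + e) * n%:R.
  by near: n; apply: admissible_near.
apply/andP; split.
  by apply: le_trans (b_seq_ge n0); rewrite lee_fin gerBl ltW.
by apply: le_trans (b_seq_le n0 Hs) _; rewrite lee_fin ler_pdivrMr ?ltr0n.
Unshelve. all: by end_near.
Qed.

Lemma a_seq_cvg : a_seq (alpha%:R : R) n @[n --> \oo] --> (min_density * 2)%:E.
Proof.
apply: ereal_squeeze_cvg => e e0.
have e20 : 0 < e / 2 by rewrite divr_gt0.
(* The sample size is fixed before [n] grows, so that [4 * m / n] tends to 0. *)
have [m m0 Hm] : exists2 m, (0 < m)%N & 4 / m%:R <= e / 2.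
  have [N _ HN] := near_ge_div 4 e20.
  by exists N.+1 => //; apply: HN => /=.
have Hpred : \forall n \near \oo,
    exists2 s, admissible n.-1 s & s <= (min_density + e / 2) * n.-1%:R.
  have [N _ HN] := admissible_near e20.
  by exists N.+1 => // n /= Nn; apply: HN => /=; lia.
near=> n; apply/andP; split.
  have n0 : (0 < n)%N by near: n; exists 1%N.
  apply: le_trans (a_seq_ge n0 m0); rewrite lee_fin.
  have : 4 * m%:R / n%:R <= e / 2 by near: n; apply: near_ge_div.
  lra.
have n0 : (0 < n)%N by near: n; exists 1%N.
have [s Hs Hse] : exists2 s, admissible n.-1 s & s <= (min_density + e / 2) * n.-1%:R.
  by near: n.
have := a_seq_le Hs; rewrite prednK // => /le_trans; apply.
rewrite lee_fin ler_pdivrMr ?ltr0n //.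
have : s <= (min_density + e / 2) * n%:R.
  apply: le_trans Hse _; rewrite ler_wpM2l ?ler_nat ?leq_pred //.
  by rewrite addr_ge0 ?min_density_ge0 // ltW.
lra.
Unshelve. all: by end_near.
Qed.

Lemma min_density_le_tree :
  min_density <= (alpha%:R - 1) / (alpha%:R * (alpha%:R - 2)).
Proof.
have [a Ea] : exists a, alpha = a.+3 by exists (alpha - 3)%N; lia.
set rhs := (X in _ <= X).
have rhsE : rhs = a.+2%:R / (a.+3%:R * a.+1%:R).
  have a_ge0 := ler0n R a; rewrite /rhs Ea -!natr1; field.
  by do ?[apply/andP; split]; apply: lt0r_neq0; lra.
apply/ler_addgt0Pr => e e0; have e20 : 0 < e / 2 by rewrite divr_gt0.
(* First [L] makes the pendant edges that pay for the root edges cheap; then [h] absorbs the tail,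
   whose length depends on [L]. *)
have [L HL] : exists L : nat, 2 / L.+2%:R <= e / 2.
  have [N _ HN] := near_ge_div 2 e20.
  by exists N; apply: HN => /=; lia.
have [h Hh] : exists h : nat, (1 + L.+2.*2%:R) / 2 ^+ h <= e / 2.
  have [N _ HN] := near_ge_div (1 + L.+2.*2%:R) e20.
  exists N.+1; apply: le_trans (HN N.+1 _); last by rewrite /=; lia.
  apply: ler_wpM2l; first by apply: addr_ge0; [exact: ler01 | exact: ler0n].
  rewrite lef_pV2 ?posrE ?exprn_gt0 ?ltr0n //.
  by rewrite -natrX ler_nat ltnW // ltn_expl.
have [p p0 Hnet] := tree_like_net R a h L.
have pR : 0 < p%:R :> R by rewrite ltr0n.
have LR : 0 < L.+2%:R :> R by rewrite ltr0n.
have n0 : (0 < p * L.+2 + p.*2)%N by rewrite addn_gt0 muln_gt0 p0.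
have Hk : ((p * L.+2 * a.+3 %/ 2 + p).*2 <= alpha * (p * L.+2) + p.*2)%N by lia.
apply: le_trans (min_density_le n0 (admissible_slack Hnet Hk)) _.
rewrite ler_pdivrMr ?ltr0n // -rhsE.
set t := (1 + L.+2.*2%:R) / 2 ^+ h in Hh *.
have rhs0 : 0 <= rhs by rewrite rhsE divr_ge0 // mulr_ge0.
apply: le_trans (_ : (p * L.+2)%:R * (rhs + e) <= _); last first.
  by rewrite mulrC ler_wpM2l ?ler_nat ?leq_addr // addr_ge0 // ltW.
have H2 : p.*2%:R <= (p * L.+2)%:R * (e / 2).
  by move: HL; rewrite -muln2 !natrM -mulrA ler_pM2l // ler_pdivrMr // mulrC.
have H3 : (p * L.+2)%:R * t <= (p * L.+2)%:R * (e / 2) by rewrite ler_wpM2l.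
lra.
Qed.

End Limits.

Theorem corollary11 (R : realType) (alpha : nat) (halpha : (3 <= alpha)%N) :
  (cvg (b_seq (alpha%:R : R) n @[n --> \oo]) /\
   (b_lim (alpha%:R : R)
      <= ((alpha%:R - 1) / (alpha%:R * (alpha%:R - 2)))%:E)%E) /\
  (cvg (a_seq (alpha%:R : R) n @[n --> \oo]) /\
   (a_lim (alpha%:R : R)
      <= ((2 * (alpha%:R - 1)) / (alpha%:R * (alpha%:R - 2)))%:E)%E).
Proof.
have Hb := @b_seq_cvg R alpha halpha; have Ha := @a_seq_cvg R alpha halpha.
have Hd := @min_density_le_tree R alpha halpha.
split; split; try by apply/cvg_ex; eexists; eassumption.
  by rewrite /b_lim (cvg_lim _ Hb) // lee_fin.
rewrite /a_lim (cvg_lim _ Ha) // lee_fin -mulrA [leRHS]mulrC.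
by rewrite ler_wpM2r.
Qed.
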